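(* Let $X$ be a Cantor space and let $\mu\in M^0_\infty(X)$. Then: (1) For any clopen set $U$ with $\mu(U)=\infty$ and any $a>0$ there exists a clopen subset $V\subset U$ such that $a\le\mu(V)<\infty$. (2) $X=\bigsqcup_{i=1}^\infty V_i\sqcup\mathfrak{M}_\mu$, where each $V_i$ is a clopen set of finite measure and $\mathfrak{M}_\mu$ is closed, nowhere dense and has zero measure. (3) $\mu$ is $\sigma$-finite. (4) $\mu$ is uniquely determined (among measures in $M^0_\infty(X)$) by its values on the algebra of clopen sets.
   Context: A Cantor space is a non-empty zero-dimensional compact perfect metric space. A Borel measure on a Cantor space $X$ is full if every non-empty open set has positive measure. $M_\infty(X)$ is the set of all full non-atomic Borel measures $\mu$ on $X$ with $\mu(X)=\infty$. For $\mu\in M_\infty(X)$ the defective set is $\mathfrak{M}_\mu=\{x\in X:\mu(U)=\infty\text{ for every clopen }U\ni x\}$, and $M^0_\infty(X)=\{\mu\in M_\infty(X):\mu(\mathfrak{M}_\mu)=0\}$ is the class of non-defective measures. *)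

(* Defs.v *)
From HB Require Import structures.
From mathcomp Require Import all_boot all_order all_algebra.
From mathcomp Require Import all_classical all_reals all_analysis.

Set Implicit Arguments.
Unset Strict Implicit.
Unset Printing Implicit Defensive.

Local Open Scope classical_set_scope.
Local Open Scope ring_scope.
Local Open Scope ereal_scope.

(* Measurable types are pointed, so non-emptiness of the space is carried by
   the choice of a point. *)
#[short(type="pmetricType")]
HB.structure Definition PMetric (R : numDomainType) :=
  {T of Pointed T & Metric R T}.

(* X with its Borel sigma-algebra. A measure on it is a function on all subsets
   of X, about which only the values on Borel sets are meaningful. *)
Notation borel X := (g_sigma_algebraType (@open X)).

Definition nowhere_dense (T : topologicalType) (A : set T) :=
  interior (closure A) = set0.

Section measures_on_cantor_spaces.
Context {R : realType} {X : pmetricType R}.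
Implicit Type mu : {measure set (borel X) -> \bar R}.

Definition full mu := forall U : set X, open U -> U !=set0 -> 0 < mu U.

Definition atom mu (A : set (borel X)) :=
  [/\ measurable A, 0 < mu A &
      forall B : set (borel X), measurable B -> B `<=` A ->
        mu B = 0 \/ mu (A `\` B) = 0].

Definition nonatomic mu := forall A : set (borel X), ~ atom mu A.

Definition M_infty : set {measure set (borel X) -> \bar R} :=
  [set mu | [/\ full mu, nonatomic mu & mu setT = +oo]].

Definition defective mu : set X :=
  [set x | forall U : set X, clopen U -> U x -> mu U = +oo].

Definition M0_infty : set {measure set (borel X) -> \bar R} :=
  [set mu | M_infty mu /\ mu (defective mu) = 0].

End measures_on_cantor_spaces.

Arguments M_infty {R} X.
Arguments M0_infty {R} X.

(* Main.v *)
(* A compact metric space has countably many clopen sets, and by definition the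
   complement of the defective set is the union of those of finite measure. *)
Require Import Defs.
From mathcomp Require Import all_boot all_order all_algebra.
From mathcomp Require Import all_classical all_reals all_analysis.

Import Order.TTheory.

Local Open Scope classical_set_scope.
Local Open Scope ring_scope.
Local Open Scope ereal_scope.

(** Everything rests on one countable cover: the complement of the defective set is a union of
    clopen sets [F i] of finite measure ([setC_defective_seq]). Disjointifying it gives the
    partition, and adding the null defective set gives sigma-finiteness. Inside a clopen [U] of
    infinite measure, the traces of the finite unions of the [F i] have finite measures increasing
    to infinity. Fullness forbids a closed null set to have interior points. For uniqueness, the
    clopen values already determine the defective set, so both measures share the cover and agree on
    a pi-system generating the Borel sets. *)

Lemma clopenD {T : topologicalType} (A B : set T) :
  clopen A -> clopen B -> clopen (A `\` B).
Proof. by move=> cA cB; rewrite setDE; apply: clopenI => //; exact: clopenC. Qed.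

Lemma clopen_bigsetU {T : topologicalType} (F : (set T)^nat) n :
  (forall i, clopen (F i)) -> clopen (\big[setU/set0]_(i < n) F i).
Proof.
by move=> cF; apply: big_ind => //; [exact: clopen0|exact: clopenU].
Qed.

Lemma clopen_seqDU {T : topologicalType} (F : (set T)^nat) n :
  (forall i, clopen (F i)) -> clopen (seqDU F n).
Proof. by move=> cF; apply: clopenD => //; exact: clopen_bigsetU. Qed.

(** By second countability and compactness a clopen set is a finite union of basic open sets, so
    there are countably many. As [P] is inhabited, a sequence, possibly with repetitions, exhausts
    it. *)
Lemma clopen_family_seq {R : realType} {X : pseudoPMetricType R}
    (P : set (set X)) :
  compact [set: X] -> P `<=` clopen -> P !=set0 ->
  exists2 F : (set X)^nat, (forall i, P (F i)) &
    \bigcup_i F i = \bigcup_(A in P) A.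
Proof.
move=> cX Pcl [A0 PA0].
have cP : countable P.
  exact: sub_countable (subset_card_le Pcl)
    (clopen_countable cX (compact_second_countable cX)).
move: cP => /pfcard_geP[P0|/unsquash f]; first by rewrite P0 in PA0.
exists f; first by move=> i; exact: funS.
apply/seteqP; split=> x [i Pi xi]; first by exists (f i) => //; exact: funS.
by have [n _ fn] := @surj _ _ _ _ f _ Pi; exists n => //; rewrite fn.
Qed.

(** [zero_dimensional] only separates points by clopen sets; compactness upgrades this to a clopen
    base. Hence clopen sets generate the Borel sets. *)
Lemma open_bigcup_clopen {R : realType} {X : pseudoPMetricType R} (U : set X) :
  compact [set: X] -> hausdorff_space X -> zero_dimensional X -> open U ->
  exists2 F : (set X)^nat, (forall i, clopen (F i)) & U = \bigcup_i F i.
Proof.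
move=> cX hX zX oU.
have [| |F PF UF] := @clopen_family_seq _ _ (fun A => clopen A /\ A `<=` U) cX.
- by move=> A [].
- by exists set0; split; [exact: clopen0|exact: sub0set].
exists F => [i|]; first by have [] := PF i.
rewrite UF; apply/seteqP; split=> x; last by case=> A [_ AU] /AU.
move=> Ux; have := @zero_dimensional_cvg _ x hX zX cX.
move=> /(_ U (open_nbhs_nbhs (conj oU Ux)))[A [Ax cA] AU].
by exists A.
Qed.

Section borel_measures.
Context {R : realType} {X : pmetricType R}.
Implicit Types mu nu : {measure set (borel X) -> \bar R}.

Lemma open_borel (U : set X) : open U -> measurable (U : set (borel X)).
Proof. exact: sub_sigma_algebra. Qed.

Lemma closed_borel (A : set X) : closed A -> measurable (A : set (borel X)).
Proof.
move=> cA; rewrite -[A]setCK; apply: measurableC; apply: open_borel.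
exact: closed_openC.
Qed.

Lemma clopen_borel (A : set X) : clopen A -> measurable (A : set (borel X)).
Proof. by case=> /open_borel. Qed.

Lemma setC_defective mu : ~` defective mu =
  \bigcup_(A in [set A : set X | clopen A /\ mu A < +oo]) A.
Proof.
apply/seteqP; split=> x.
  move=> /existsNP[A] /not_implyP[cA] /not_implyP[Ax] /eqP Aoo.
  by exists A => //; split=> //; rewrite ltey.
by case=> A [cA Aoo] Ax /(_ A cA Ax) Aeq; rewrite Aeq ltxx in Aoo.
Qed.

Lemma closed_defective mu : closed (defective mu).
Proof.
rewrite -[defective mu]setCK setC_defective; apply: open_closedC.
by apply: bigcup_open => A [[]].
Qed.

Lemma full_nowhere_dense mu (A : set X) :
  full mu -> closed A -> mu A = 0 -> nowhere_dense A.
Proof.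
move=> fmu cA muA; rewrite /nowhere_dense -(closure_id _).1//.
apply: contrapT => /eqP/set0P A0.
have := fmu _ (open_interior A) A0; apply/negP; rewrite -leNgt -muA.
apply: le_measure; rewrite ?inE; [|exact: closed_borel|exact: interior_subset].
by apply: open_borel; exact: open_interior.
Qed.

Lemma setC_defective_seq mu : compact [set: X] ->
  exists2 F : (set X)^nat, (forall i, clopen (F i) /\ mu (F i) < +oo) &
    \bigcup_i F i = ~` defective mu.
Proof.
move=> cX; rewrite setC_defective; apply: clopen_family_seq => //.
  by move=> A [].
by exists set0; split; [exact: clopen0|rewrite measure0].
Qed.

(** Removing from each [F i] the finitely many earlier ones keeps it clopen and of finite measure;
    some pieces may be empty. *)
Lemma setC_defective_trivIset mu : compact [set: X] ->
  exists V : (set X)^nat, [/\ forall i, clopen (V i) /\ mu (V i) < +oo,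
    trivIset setT V & \bigcup_i V i = ~` defective mu].
Proof.
move=> /(setC_defective_seq mu)[F cF UF]; exists (seqDU F); split.
- move=> i; have cV : clopen (seqDU F i) by apply: clopen_seqDU => j; case: (cF j).
  split=> //; apply: le_lt_trans (cF i).2.
  apply: le_measure; rewrite ?inE; [exact: clopen_borel| |exact: subset_seqDU].
  by apply: clopen_borel; case: (cF i).
- exact: trivIset_seqDU.
- by rewrite -seqDU_bigcup_eq.
Qed.

Lemma clopen_large_finite mu (U : set X) (a : R) : compact [set: X] ->
  mu (defective mu) = 0 -> clopen U -> mu U = +oo ->
  exists V : set X, [/\ clopen V, V `<=` U & a%:E <= mu V < +oo].
Proof.
move=> cX mu0 cU Uoo; have [F cF UF] := setC_defective_seq mu cX.
have clF i : clopen (F i) by case: (cF i).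
pose G n := U `&` \big[setU/set0]_(i < n) F i.
have cG n : clopen (G n) by apply: clopenI => //; exact: clopen_bigsetU.
have UG : \bigcup_n G n = U `\` defective mu.
  rewrite -setI_bigcupr setDE -UF; congr (_ `&` _).
  apply/seteqP; split=> x [n _].
    by rewrite -bigcup_mkord => -[i _ ?]; exists i.
  by move=> Fnx; exists n.+1 => //; rewrite -bigcup_mkord; exists n => /=.
have mD := closed_borel _ (closed_defective mu).
have mG n : measurable (G n : set (borel X)) by exact: clopen_borel.
have ndG : nondecreasing_seq G.
  by move=> m n mn; apply/subsetPset; apply: setIS; exact: subset_bigsetU.
have GU : (mu \o G) n @[n --> \oo] --> +oo.
  (* Continuity from below: the limit is the measure of [U] minus the defective set, which equals
     that of [U] because the removed part is null. *)
  rewrite (_ : +oo = mu (\bigcup_n G n)).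
    by apply: nondecreasing_cvg_mu => //; exact: bigcupT_measurable.
  rewrite UG -Uoo (measureDI _ (clopen_borel _ cU) mD).
  rewrite [X in _ + X](subset_measure0 _ mD _ mu0) ?adde0//.
  by apply: measurableI => //; exact: clopen_borel.
have [N _ /(_ N (leqnn N)) aN] := cvgey_ge GU a.
exists (G N); split=> //; first exact: subIsetl.
apply/andP; split=> //.
have mF i : measurable (F i : set (borel X)) by exact: clopen_borel.
(* Finiteness comes from subadditivity over the first [N] sets of the cover. *)
apply: (@le_lt_trans _ _ (mu (\big[setU/set0]_(i < N) F i))).
  apply: le_measure; rewrite ?inE//; last exact: subIsetr.
  exact: bigsetU_measurable.
apply: le_lt_trans (le_mu_bigsetU _ _) _ => //.
by apply/lte_sum_pinfty => i _; case: (cF i).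
Qed.

Lemma sigma_finite_nondefective mu : compact [set: X] ->
  mu (defective mu) = 0 -> sigma_finite setT mu.
Proof.
move=> cX mu0; have [F cF UF] := setC_defective_seq mu cX.
exists (fun n => if n is m.+1 then F m else defective mu).
  apply/esym/seteqP; split=> // x _; have [Dx|nDx] := pselect (defective mu x).
    by exists 0%N.
  have : (~` defective mu) x by [].
  by rewrite -UF => -[n _ Fnx]; exists n.+1.
case=> [|n]; last by have [/clopen_borel] := cF n.
by rewrite mu0; split=> //; apply: closed_borel; exact: closed_defective.
Qed.

(** Transfers the nullity of the defective set of [nu] to that of [mu], so that one cover serves
    both measures. *)
Lemma eq_defective mu nu :
  (forall U : set X, clopen U -> nu U = mu U) -> defective nu = defective mu.
Proof.
move=> numu; apply/seteqP.
by split=> x xD U cU Ux; [rewrite -numu//|rewrite numu//]; exact: xD.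
Qed.

(* Restricting to clopen sets would not do: the cover by sets of finite measure
   also needs the defective set, and its closed subsets restore stability under
   intersection. *)
Lemma nondefective_measure_unique mu nu : compact [set: X] ->
  hausdorff_space X -> zero_dimensional X ->
  mu (defective mu) = 0 -> nu (defective nu) = 0 ->
  (forall U : set X, clopen U -> nu U = mu U) ->
  forall A : set (borel X), measurable A -> nu A = mu A.
Proof.
move=> cX hX zX mu0 nu0 numu; rewrite (eq_defective mu) // in nu0.
have mD := closed_borel _ (closed_defective mu).
pose G := [set A : set (borel X) |
  clopen (A : set X) \/ closed (A : set X) /\ A `<=` defective mu].
have [F cF UF] := setC_defective_seq mu cX.
apply: (measure_unique G (fun n => if n is m.+1 then F m else defective mu)).
- apply/seteqP; split.
    apply: smallest_sub; first exact: smallest_sigma_algebra.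
    move=> U oU; have [E cE ->] := open_bigcup_clopen _ cX hX zX oU.
    by apply: sigma_algebra_bigcup => i; apply: sub_sigma_algebra; left.
  apply: smallest_sub; first exact: sigma_algebra_measurable.
  by move=> A [/clopen_borel//|[/closed_borel]].
(* Every member of [G] is closed, so its intersection with a closed subset of the defective set is
   again such a subset. *)
- move=> A B GA GB; have cl C : G C -> closed (C : set X) by case=> [[]|[]].
  case: GA (cl _ GA) => [cA|[_ AD]] clA; last first.
    by right; split; [apply: closedI => //; exact: cl|move=> x [/AD]].
  case: GB (cl _ GB) => [cB|[_ BD]] clB; first by left; exact: clopenI.
  by right; split; [exact: closedI|move=> x [_ /BD]].
- case=> [|n]; last by left; case: (cF n).
  by right; split=> //; exact: closed_defective.
- apply/seteqP; split=> // x _; have [Dx|nDx] := pselect (defective mu x).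
    by exists 0%N.
  have : (~` defective mu) x by [].
  by rewrite -UF => -[n _ Fnx]; exists n.+1.
(* Subsets of the defective set are null for both measures. *)
- move=> A [/numu//|[/closed_borel mA AD]].
  by rewrite !(subset_measure0 mA mD AD).
- case=> [|n]; first by rewrite nu0.
  by have [cFn Foo] := cF n; rewrite numu.
Qed.

End borel_measures.

Theorem proposition2p4 (R : realType) (X : pmetricType R)
    (mu : {measure set (borel X) -> \bar R}) :
  cantor_like X -> M0_infty X mu ->
  [/\
      forall (U : set X) (a : R), clopen U -> mu U = +oo -> (0 < a)%R ->
        exists V : set X, [/\ clopen V, V `<=` U & a%:E <= mu V < +oo],
      (exists V : (set X)^nat,
        [/\ forall i, clopen (V i) /\ mu (V i) < +oo,
            trivIset setT V,
            \bigcup_i V i `&` defective mu = set0 &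
            \bigcup_i V i `|` defective mu = setT]) /\
      [/\ closed (defective mu), nowhere_dense (defective mu) &
          mu (defective mu) = 0],
      sigma_finite setT mu &
      forall nu : {measure set (borel X) -> \bar R}, M0_infty X nu ->
        (forall U : set X, clopen U -> nu U = mu U) ->
        forall A : set (borel X), measurable A -> nu A = mu A].
Proof.
move=> [_ cX hX zX] [[fmu _ _] mu0]; split.
- by move=> U a cU Uoo _; exact: clopen_large_finite.
- split; last first.
    have cD := closed_defective mu.
    by split=> //; exact: full_nowhere_dense fmu cD mu0.
  have [V [cV tV UV]] := setC_defective_trivIset mu cX.
  by exists V; split=> //; rewrite UV ?setICl// setUC setUv.
- exact: sigma_finite_nondefective.
- by move=> nu [_ nu0] numu; exact: nondefective_measure_unique.
Qed.
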